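(* Let $n,m\in\mathbb{N}$, and let $A,X,f$ satisfy: (a) $A\in\{0,1\}^{n\times m}$ has no zero column, i.e. $A\mathbf{e}_j\ne\mathbf{0}_n$ for all $j\in[m]$; (b) $\{\mathbf{0}_m,\mathbf{e}_1,\dots,\mathbf{e}_m\}\subseteq X\subseteq\mathbb{R}^m_+$; (c) $f:X\to\mathbb{R}$ satisfies $f(\mathbf{0}_m)=0$ and $f(x)\le\sum_{j=1}^m f(\mathbf{e}_j)x_j$ for all $x\in X$. For $w\in\{0,1\}^n$ define $$\nu_{X,f}(w)=\max_{x\in X}[f(x): Ax\le w],\qquad \nu_{\mathbb{R}^m_+,F}(w)=\max_{x\in\mathbb{R}^m_+}[F(x): Ax\le w],\qquad F(x)=\sum_{j=1}^m f(\mathbf{e}_j)x_j .$$ Then: (i) $\mathrm{core}(\nu_{X,f})\neq\emptyset$ if and only if $\nu_{X,f}(\mathbf{1}_n)=\nu_{\mathbb{R}^m_+,F}(\mathbf{1}_n)$. (ii) Whenever $\mathrm{core}(\nu_{X,f})$ is non-empty, $$\mathrm{core}(\nu_{X,f})=\operatorname*{arg\,min}_{y\in\mathbb{R}^n_+}\left[\mathbf{1}_n^Ty:\ y^TA\ge (f(\mathbf{e}_1),\dots,f(\mathbf{e}_m))\right].$$ (iii) If $X=\{0,1\}^m$ and $\mathrm{core}(\nu_{X,f})$ is non-empty, then the linear program $\max_{x\in\mathbb{R}^m_+}[F(x):Ax\le\mathbf{1}_n]$ has an integer optimal solution.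
   Context: Notation: $[m]=\{1,\dots,m\}$; $\mathbf{0}_n,\mathbf{1}_n$ are the all-zero and all-one vectors in $\mathbb{R}^n$; $\mathbf{e}_j$ is the $j$-th unit vector; $\mathbb{R}^m_+$ is the set of componentwise non-negative vectors; vector inequalities are componentwise. Standing convention: the maximum defining $\nu_{X,f}(w)$ is attained for every $w\in\{0,1\}^n$, so $\nu_{X,f}$ is real-valued. The core of a (revenue) game $\nu:\{0,1\}^n\to\mathbb{R}$ is $\mathrm{core}(\nu)=\{y\in\mathbb{R}^n:\mathbf{1}_n^Ty=\nu(\mathbf{1}_n),\ a^Ty\ge\nu(a)\ \forall a\in\{0,1\}^n\}$. *)

(* Defs.v *)
From mathcomp Require Import all_boot all_order all_algebra.
From mathcomp Require Import all_classical reals.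

Set Implicit Arguments.
Unset Strict Implicit.
Unset Printing Implicit Defensive.

Import Order.TTheory GRing.Theory Num.Theory.

Local Open Scope classical_set_scope.
Local Open Scope ring_scope.

Section Defs.
Context {R : realType}.

Definition unit_vec {m : nat} (j : 'I_m) : 'cV[R]_m := delta_mx j 0.

Definition ones (n : nat) : 'cV[R]_n := const_mx 1.

Definition dot {n : nat} (u v : 'cV[R]_n) : R := (u^T *m v) 0 0.

Definition lemx {p q : nat} (M N : 'M[R]_(p, q)) : Prop :=
  forall i j, M i j <= N i j.

Definition zero_one (p q : nat) : set 'M[R]_(p, q) :=
  [set M | forall i j, M i j = 0 \/ M i j = 1].

Definition nonneg_orthant (m : nat) : set 'cV[R]_m := [set x | lemx 0 x].

Definition argmax {T : Type} (D : set T) (g : T -> R) : set T :=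
  [set x | D x /\ forall z, D z -> g z <= g x].

Definition argmin {T : Type} (D : set T) (g : T -> R) : set T :=
  [set x | D x /\ forall z, D z -> g x <= g z].

(* The greatest element of S; a junk value (0) if S has none. *)
Definition maximum (S : set R) : R := xget 0 (S `&` ubound S).

Definition feasible {n m : nat} (A : 'M[R]_(n, m)) (X : set 'cV[R]_m)
    (w : 'cV[R]_n) : set 'cV[R]_m :=
  [set x | X x /\ lemx (A *m x) w].

(* A function f : X -> R is represented by any of its total extensions: only
   its values on X are used. Likewise a game on {0,1}^n is a total function on
   column vectors of which only the values at 0/1 vectors are used. *)
Definition game {n m : nat} (A : 'M[R]_(n, m)) (X : set 'cV[R]_m)
    (f : 'cV[R]_m -> R) (w : 'cV[R]_n) : R :=
  maximum [set f x | x in feasible A X w].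

Definition core {n : nat} (nu : 'cV[R]_n -> R) : set 'cV[R]_n :=
  [set y | dot (ones n) y = nu (ones n) /\
           forall a, zero_one a -> nu a <= dot a y].

Definition linearization {m : nat} (f : 'cV[R]_m -> R) (x : 'cV[R]_m) : R :=
  \sum_(j < m) f (unit_vec j) * x j 0.

End Defs.

Arguments ones {R} n.
Arguments zero_one {R p q}.
Arguments nonneg_orthant {R} m.

(* Main.v *)
Require Import Defs.
From mathcomp Require Import all_boot all_order all_algebra.
From mathcomp Require Import all_classical reals.
From mathcomp Require Import lra.

Set Implicit Arguments.
Unset Strict Implicit.
Unset Printing Implicit Defensive.

Import Order.TTheory GRing.Theory Num.Theory.

Local Open Scope classical_set_scope.
Local Open Scope ring_scope.

(** Write [c] for the row of values [f e_j].  By the bound on [f], the LP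
[max c x, A x <= 1, x >= 0] is a relaxation of the program defining the value
of the grand coalition; its dual is [min 1^T y, y^T A >= c, y >= 0].

Every core element [y] is dual feasible: coalition [e_i] can afford [x = 0], so
[y_i >= f 0 = 0], and coalition [A e_j] can afford [e_j], so
[(y^T A)_j >= f e_j].  As [1^T y] is the value of the grand coalition, weak
duality makes [y] dual optimal and every maximizer [x] of that value a primal
optimum with [f x = c x] ([core_argmax]).  For [X = {0,1}^m] this [x] is an
integral LP optimum.  Conversely a dual feasible [y] with [1^T y] equal to the
value of the grand coalition lies in the core, again by weak duality
([dual_feasible_core]); so once the core is nonempty it is exactly the set of
dual optima.

Only the existence of a core element when the two values agree needs strong
duality ([lp_strong_duality]).  It is derived from a Farkas alternative
([farkas]), itself obtained by Fourier-Motzkin elimination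
([fourier_motzkin]).  The primal is feasible at [0], and the dual is feasible
because every column of the 0/1 matrix [A] contains a 1. *)

(** * Linear inequalities and linear programming duality *)

Section LinearProgramming.
Context {R : realType}.

(** Two finite sets, one below the other, are separated by a point; either may
be empty. *)
Lemma seq_le_between (L U : seq R) :
  (forall l u, l \in L -> u \in U -> l <= u) ->
  exists t, (forall l, l \in L -> l <= t) /\ (forall u, u \in U -> t <= u).
Proof.
elim: L => [_|l L IH LU].
  elim: U => [|u U [t [_ tU]]]; first by exists 0.
  exists (Num.min u t); split=> // v; rewrite inE => /predU1P[->|/tU tv].
    by rewrite ge_min lexx.
  by rewrite ge_min tv orbT.
have [|t [Lt tU]] := IH.
  by move=> l' u l'L uU; apply: LU => //; rewrite inE l'L orbT.
exists (Num.max l t); split.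
  move=> l'; rewrite inE => /predU1P[->|/Lt l't].
    by rewrite le_max lexx.
  by rewrite le_max l't orbT.
by move=> u uU; rewrite ge_max tU // LU // inE eqxx.
Qed.

(** A pair [(a, b)] stands for the inequality [a x <= b].  If finitely many such
pairs lie in a convex cone [C], then the system is solvable or [C] contains a
contradiction [0 <= b] with [b < 0].  The induction is on a bound [k] on the
indices of the variables that occur, so the dimension stays fixed. *)
Lemma fourier_motzkin (q : nat) (C : 'rV[R]_q -> R -> Prop)
    (CD : forall a b a' b', C a b -> C a' b' -> C (a + a') (b + b'))
    (CZ : forall t a b, 0 < t -> C a b -> C (t *: a) (t * b))
    (k : nat) (s : seq ('rV[R]_q * R)) :
    (forall e, e \in s -> C e.1 e.2) ->
    (forall e (j : 'I_q), e \in s -> (k <= j)%N -> e.1 0 j = 0) ->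
  (exists x : 'cV[R]_q, forall e, e \in s -> (e.1 *m x) 0 0 <= e.2) \/
  (exists2 b, b < 0 & C 0 b).
Proof.
elim: k s => [|k IH] s sC s0.
  have e0 e : e \in s -> e.1 = 0.
    by move=> es; apply/rowP => j; rewrite s0 // mxE.
  have [/hasP[e es elt]|/hasPn sge] := boolP (has (fun e => e.2 < 0) s).
    by right; exists e.2 => //; rewrite -(e0 _ es); exact: sC.
  left; exists 0 => e es; rewrite mulmx0 mxE leNgt; exact: sge.
have [kq|qk] := ltnP k q; last first.
  by apply: IH => // e j es kj; have := leq_trans qk kj; rewrite leqNgt ltn_ord.
pose h := Ordinal kq.
(* The variable [h] is eliminated: constraints without it are kept, and each
   upper bound on it is combined with each lower bound so that it cancels. *)
pose zer := [seq e : 'rV[R]_q * R <- s | e.1 0 h == 0].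
pose pos := [seq e : 'rV[R]_q * R <- s | 0 < e.1 0 h].
pose neg := [seq e : 'rV[R]_q * R <- s | e.1 0 h < 0].
pose elim_h (e e' : 'rV[R]_q * R) : 'rV[R]_q * R :=
  (e.1 0 h *: e'.1 + (- e'.1 0 h) *: e.1, e.1 0 h * e'.2 + (- e'.1 0 h) * e.2).
have [|e j|[x xs]|] := IH (zer ++ [seq elim_h e e' | e <- pos, e' <- neg]).
- move=> e; rewrite mem_cat mem_filter => /orP[/andP[_ /sC//]|].
  case/allpairsP => -[e1 e2] /= []; rewrite !mem_filter.
  move=> /andP[e1p e1s] /andP[e2n e2s] -> /=.
  by apply: CD; apply: CZ; rewrite ?oppr_gt0 //; exact: sC.
- rewrite mem_cat mem_filter => /orP[/andP[/eqP eh es]|].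
    rewrite leq_eqVlt => /predU1P[kj|]; last exact: s0.
    by rewrite -eh; congr (e.1 0 _); apply: val_inj.
  case/allpairsP => -[e1 e2] /= []; rewrite !mem_filter.
  move=> /andP[e1p e1s] /andP[e2n e2s] -> /=.
  rewrite leq_eqVlt => /predU1P[kj|kj]; rewrite !mxE.
    by have <- : h = j by [apply: val_inj]; rewrite mulNr mulrC subrr.
  by rewrite (s0 e1 j) // (s0 e2 j) // !mulr0 addr0.
- left.
  (* [bnd e] is the bound that [e] puts on the shift of coordinate [h] of [x]:
     an upper bound for [e] in [pos], a lower bound for [e] in [neg]. *)
  pose bnd (e : 'rV[R]_q * R) := (e.2 - (e.1 *m x) 0 0) / e.1 0 h.
  have [|t [negt post]] := @seq_le_between (map bnd neg) (map bnd pos).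
    move=> _ _ /mapP[e' e'n ->] /mapP[e ep ->].
    have /xs : elim_h e e' \in zer ++ [seq elim_h e e' | e <- pos, e' <- neg].
      by rewrite mem_cat allpairs_f ?orbT.
    move: e'n ep; rewrite !mem_filter /= => /andP[e'n _] /andP[ep _].
    rewrite mulmxDl -!scalemxAl [fun_of_matrix (_ + _) _ _]mxE.
    rewrite ![fun_of_matrix (_ *: _) _ _]mxE /bnd.
    rewrite ler_ndivrMr // mulrAC ler_pdivrMr //.
    lra.
  exists (x + t *: delta_mx h 0) => e es.
  have -> : (e.1 *m (x + t *: delta_mx h 0)) 0 0 =
            (e.1 *m x) 0 0 + t * e.1 0 h.
    by rewrite mulmxDr -scalemxAr -colE !mxE.
  have [eh|eh|eh] := ltgtP (e.1 0 h) 0.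
  + have : bnd e <= t by apply/negt/map_f; rewrite mem_filter eh.
    by rewrite /bnd ler_ndivrMr //; lra.
  + have : t <= bnd e by apply/post/map_f; rewrite mem_filter eh.
    by rewrite /bnd ler_pdivlMr //; lra.
  + by rewrite eh mulr0 addr0; apply: xs; rewrite mem_cat mem_filter eh eqxx es.
- by right.
Qed.

Lemma lemx_mul2l (p q r : nat) (M : 'M[R]_(p, q)) (N N' : 'M[R]_(q, r)) :
  lemx 0 M -> lemx N N' -> lemx (M *m N) (M *m N').
Proof.
move=> M0 NN i j; rewrite !mxE; apply: ler_sum => k _.
by apply: ler_wpM2l => //; have := M0 i k; rewrite mxE.
Qed.

Lemma lemx_mul2r (p q r : nat) (M M' : 'M[R]_(p, q)) (N : 'M[R]_(q, r)) :
  lemx 0 N -> lemx M M' -> lemx (M *m N) (M' *m N).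
Proof.
move=> N0 MM i j; rewrite !mxE; apply: ler_sum => k _.
by apply: ler_wpM2r => //; have := N0 k j; rewrite mxE.
Qed.

Lemma lemx_trans (p q : nat) (M N P : 'M[R]_(p, q)) :
  lemx M N -> lemx N P -> lemx M P.
Proof. by move=> MN NP i j; exact: le_trans (MN i j) (NP i j). Qed.

Lemma lemx_tr (p q : nat) (M N : 'M[R]_(p, q)) :
  lemx M N -> lemx M^T N^T.
Proof. by move=> MN i j; rewrite !mxE. Qed.

(** Farkas alternative for [M x <= b], [x >= 0]. *)
Lemma farkas (p q : nat) (M : 'M[R]_(p, q)) (b : 'cV[R]_p) :
  (exists2 x : 'cV[R]_q, lemx 0 x & lemx (M *m x) b) \/
  (exists u : 'rV[R]_p, [/\ lemx 0 u, lemx 0 (u *m M) & (u *m b) 0 0 < 0]).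
Proof.
(* The consequences of [M x <= b] and [x >= 0]. *)
pose C (a : 'rV[R]_q) (t : R) := exists u : 'rV[R]_p,
  [/\ lemx 0 u, lemx a (u *m M) & t = (u *m b) 0 0].
have CD a t a' t' : C a t -> C a' t' -> C (a + a') (t + t').
  move=> [u [u0 ua ->]] [v [v0 va ->]]; exists (u + v); split.
  - move=> i j; have := v0 i j; have := u0 i j; rewrite !mxE; exact: addr_ge0.
  - rewrite mulmxDl => i j; rewrite [leLHS]mxE [leRHS]mxE; exact: lerD.
  - by rewrite mulmxDl [RHS]mxE.
have CZ t a t' : 0 < t -> C a t' -> C (t *: a) (t * t').
  move=> t0 [u [u0 ua ->]]; exists (t *: u); split.
  - by move=> i j; have := u0 i j; rewrite !mxE; apply: mulr_ge0; exact: ltW.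
  - rewrite -scalemxAl => i j; rewrite [leLHS]mxE [leRHS]mxE.
    by rewrite ler_pM2l.
  - by rewrite -scalemxAl [RHS]mxE.
pose s : seq ('rV[R]_q * R) :=
  [seq (row i M, b i 0) | i <- enum 'I_p] ++
  [seq (- delta_mx 0 j, 0) | j <- enum 'I_q].
have [||[x xs]|[t t0 [u [u0 uM tE]]]] := @fourier_motzkin q C CD CZ q s.
- move=> e; rewrite mem_cat => /orP[/mapP[i _ ->]|/mapP[j _ ->]] /=.
    exists (delta_mx 0 i); split; rewrite -?rowE ?mxE//.
    by move=> k l; rewrite !mxE ler0n.
  exists 0; split; rewrite ?mul0mx ?mxE//.
  by move=> k l; rewrite !mxE oppr_le0 ler0n.
- by move=> e j _; rewrite leqNgt ltn_ord.
- left; exists x => i j; rewrite !(ord1 j).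
    have /xs /= : (- delta_mx 0 i, 0) \in s.
      rewrite mem_cat; apply/orP; right.
      by apply/mapP; exists i; rewrite ?mem_enum.
    by rewrite mulNmx -rowE !mxE oppr_le0.
  have /xs /= : (row i M, b i 0) \in s.
    rewrite mem_cat; apply/orP; left.
    by apply/mapP; exists i; rewrite ?mem_enum.
  by rewrite -row_mul mxE.
- by right; exists u; split; rewrite // -tE.
Qed.

Lemma lp_weak_duality (n m : nat) (A : 'M[R]_(n, m)) (b : 'cV[R]_n)
    (c : 'rV[R]_m) (x : 'cV[R]_m) (y : 'cV[R]_n) :
    lemx 0 x -> lemx (A *m x) b -> lemx 0 y -> lemx c (y^T *m A) ->
  (c *m x) 0 0 <= (y^T *m b) 0 0.
Proof.
move=> x0 Ax y0 cy; apply: (@lemx_trans _ _ _ (y^T *m A *m x)).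
  exact: lemx_mul2r.
rewrite -mulmxA; apply: lemx_mul2l => //.
by rewrite -(trmx0 R); exact: lemx_tr.
Qed.

(** If the primal [max c x, A x <= b, x >= 0] and its dual are both feasible,
they have feasible points of equal value, which are therefore both optimal. *)
Lemma lp_strong_duality (n m : nat) (A : 'M[R]_(n, m)) (b : 'cV[R]_n)
    (c : 'rV[R]_m) (x0 : 'cV[R]_m) (y0 : 'cV[R]_n) :
    lemx 0 x0 -> lemx (A *m x0) b -> lemx 0 y0 -> lemx c (y0^T *m A) ->
  exists x : 'cV[R]_m, exists y : 'cV[R]_n,
    [/\ lemx 0 x, lemx (A *m x) b, lemx 0 y, lemx c (y^T *m A)
      & (c *m x) 0 0 = (y^T *m b) 0 0].
Proof.
move=> x0p Ax0 y0p cy0.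
(* The system [A x <= b], [- A^T y <= - c^T], [- c x + b^T y <= 0] in the
   stacked unknown [z = (x, y)]. *)
pose M := col_mx (block_mx A 0 0 (- A^T)) (row_mx (- c) b^T).
pose d := col_mx (col_mx b (- c^T)) (0 : 'cV[R]_1).
case: (farkas M d) => [[z z0 Mz]|[u [u0 uM ud]]].
  pose x := usubmx z; pose y := dsubmx z.
  have zE : z = col_mx x y by rewrite vsubmxK.
  have xp : lemx 0 x by move=> i j; have := z0 (lshift _ i) j; rewrite !mxE.
  have yp : lemx 0 y by move=> i j; have := z0 (rshift _ i) j; rewrite !mxE.
  move: Mz; rewrite /M /d zE mul_col_mx mul_block_col !mul0mx addr0 add0r.
  rewrite mul_row_col => Mz.
  have Ax : lemx (A *m x) b.
    move=> i j; have := Mz (lshift _ (lshift _ i)) j.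
    by rewrite !col_mxEu.
  have cy : lemx c (y^T *m A).
    move=> i j; have := Mz (lshift _ (rshift _ j)) i.
    rewrite !col_mxEu !col_mxEd mulNmx !mxE lerN2 => H; apply: le_trans H _.
    by apply: ler_sum => k _; rewrite !mxE mulrC (ord1 i).
  exists x, y; split=> //; apply/eqP; rewrite eq_le.
  rewrite (lp_weak_duality xp Ax yp cy) /=.
  have := Mz (rshift _ 0) 0; rewrite !col_mxEd mulNmx.
  rewrite [fun_of_matrix (- _ + _) _ _]mxE [fun_of_matrix (- _) _ _]mxE.
  rewrite [fun_of_matrix 0 _ _]mxE.
  rewrite -[b^T *m y]trmxK trmx_mul trmxK [fun_of_matrix _^T 0 0]mxE.
  by rewrite addrC subr_le0.
exfalso.
(* The multipliers satisfy [p A >= l c], [A q^T <= l b] and [p b < c q^T]. *)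
pose p := lsubmx (lsubmx u); pose q := rsubmx (lsubmx u).
pose l := rsubmx u 0 0.
have uE : u = row_mx (row_mx p q) l%:M by rewrite -mx11_scalar !hsubmxK.
have pp : lemx 0 p.
  by move=> i j; have := u0 i (lshift _ (lshift _ j)); rewrite !mxE.
have qp : lemx 0 q^T.
  by move=> i j; have := u0 j (lshift _ (rshift _ i)); rewrite !mxE.
have lp : 0 <= l by have := u0 0 (rshift _ 0); rewrite /l !mxE.
move: uM ud; rewrite /M /d uE mul_row_col mul_row_block.
rewrite !mul_row_col !mul_scalar_mx.
rewrite !mulmx0 scaler0 !addr0 add0r scale_row_mx add_row_mx => uM.
rewrite !mulmxN scalerN in uM *.
rewrite -[q *m c^T]trmxK trmx_mul trmxK.
rewrite [fun_of_matrix (_ - _) _ _]mxE [fun_of_matrix (- _) _ _]mxE.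
rewrite [fun_of_matrix _^T 0 0]mxE subr_lt0 => ud.
have pA : lemx (l *: c) (p *m A).
  move=> i j; have := uM i (lshift _ j).
  rewrite row_mxEl [fun_of_matrix 0 _ _]mxE.
  rewrite [fun_of_matrix (_ - _) _ _]mxE [fun_of_matrix (- _) _ _]mxE.
  by rewrite subr_ge0.
have Aq : lemx (A *m q^T) (l *: b).
  move=> i j; have := uM j (rshift _ i).
  rewrite row_mxEr -[q *m A^T]trmxK trmx_mul trmxK [fun_of_matrix 0 _ _]mxE.
  rewrite [fun_of_matrix (_ + _) _ _]mxE [fun_of_matrix (- _) _ _]mxE.
  rewrite [fun_of_matrix _^T _ _]mxE addrC subr_ge0.
  by rewrite ![fun_of_matrix (l *: _) _ _]mxE [fun_of_matrix _^T _ _]mxE.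
(* If [l = 0], the given feasible points force [c q^T <= 0 <= p b]; if [l > 0],
   weak duality for the program with data [l b] and [l c] gives
   [l (c q^T) <= l (p b)]. *)
move: lp; rewrite le_eqVlt => /predU1P[l0|lp].
  rewrite -l0 !scale0r in pA Aq.
  have pb : 0 <= (p *m b) 0 0.
    have := @lemx_mul2r _ _ _ _ _ _ x0p pA 0 0; rewrite mul0mx mxE => H.
    apply: le_trans H _; rewrite -mulmxA; exact: lemx_mul2l.
  have cq := lp_weak_duality qp Aq y0p cy0.
  rewrite mulmx0 [fun_of_matrix 0 _ _]mxE in cq.
  by move: (le_lt_trans pb ud); rewrite ltNge cq.
have pT : lemx 0 p^T by rewrite -(trmx0 R); exact: lemx_tr.
have := @lp_weak_duality _ _ A (l *: b) (l *: c) q^T p^T qp Aq pT.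
rewrite trmxK => /(_ pA); rewrite -scalemxAl -scalemxAr.
by rewrite [leLHS]mxE [leRHS]mxE ler_pM2l // leNgt ud.
Qed.

End LinearProgramming.

(** * Revenue games *)

(** When the maximum is attained, [maximum] is not the default value. *)
Lemma maximum_argmax (R : realType) (T : Type) (D : set T) (g : T -> R)
    (x : T) :
  argmax D g x -> maximum [set g z | z in D] = g x.
Proof.
move=> [Dx gx]; rewrite /maximum; case: xgetP => [v _ [[z Dz <-] gz]|noub].
  by apply/eqP; rewrite eq_le gx //= gz //; exists x.
by case: (noub (g x)); split; [exists x|move=> _ [z Dz <-]; exact: gx].
Qed.

Lemma dotC (R : realType) (n : nat) (u v : 'cV[R]_n) : dot u v = dot v u.
Proof. by rewrite /dot -[in LHS](trmxK v) -trmx_mul mxE. Qed.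

Section RevenueGame.
Context {R : realType} (n m : nat) (A : 'M[R]_(n, m))
  (X : set 'cV[R]_m) (f : 'cV[R]_m -> R).
Context (A01 : zero_one A) (Acol : forall j : 'I_m, A *m unit_vec j <> 0)
  (X0 : X 0) (Xe : forall j : 'I_m, X (unit_vec j))
  (Xnonneg : X `<=` nonneg_orthant m) (f0 : f 0 = 0)
  (fle : forall x : 'cV[R]_m, X x -> f x <= linearization f x)
  (max_attained : forall w : 'cV[R]_n, zero_one w ->
      argmax (feasible A X w) f !=set0).

Let c : 'rV[R]_m := \row_j f (unit_vec j).

(** Feasible set of the dual [min 1^T y] of the linear relaxation. *)
Definition dual_feasible : set 'cV[R]_n :=
  [set y | nonneg_orthant n y /\ lemx (\row_(j < m) f (unit_vec j)) (y^T *m A)].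

Lemma linearizationE x : linearization f x = (c *m x) 0 0.
Proof. by rewrite mxE; apply: eq_bigr => j _; rewrite mxE. Qed.

Lemma zero_one_ones : zero_one (ones n : 'cV[R]_n).
Proof. by move=> i j; right; rewrite mxE. Qed.

(** Weak duality for an arbitrary right-hand side [w]. *)
Lemma dual_bound w x y : lemx 0 x -> lemx (A *m x) w -> dual_feasible y ->
  linearization f x <= dot w y.
Proof.
move=> x0 Ax [y0 yA]; rewrite linearizationE dotC; exact: lp_weak_duality.
Qed.

Lemma game_ge w x : zero_one w -> X x -> lemx (A *m x) w -> f x <= game A X f w.
Proof.
move=> w01 Xx Ax; have [z zmax] := max_attained w01.
by rewrite /game (maximum_argmax zmax); apply: zmax.2.
Qed.

Lemma core_dual_feasible y : core (game A X f) y -> dual_feasible y.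
Proof.
move=> [_ yge]; split=> i j.
  rewrite (ord1 j) [leLHS]mxE.
  have e01 : zero_one (unit_vec i : 'cV[R]_n).
    by move=> k l; rewrite mxE; case: (_ && _); [right|left].
  have -> : y i 0 = dot (unit_vec i) y.
    by rewrite /dot trmx_delta -rowE mxE.
  apply: le_trans (yge _ e01); rewrite -f0; apply: game_ge => //.
  by rewrite mulmx0 => k l; rewrite !mxE ler0n.
rewrite (ord1 i) mxE.
have a01 : zero_one (A *m unit_vec j) by rewrite -colE => k l; rewrite mxE.
have -> : (y^T *m A) 0 j = dot (A *m unit_vec j) y.
  by rewrite dotC /dot mulmxA -colE !mxE.
by apply: le_trans (yge _ a01); apply: game_ge.
Qed.

Lemma dual_feasible_core y : dual_feasible y ->
  dot (ones n) y = game A X f (ones n) -> core (game A X f) y.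
Proof.
move=> yd y1; split=> // a a01; have [x xmax] := max_attained a01.
rewrite /game (maximum_argmax xmax).
have [[Xx Ax] _] := xmax; apply: le_trans (fle Xx) _.
by apply: dual_bound => //; exact: Xnonneg.
Qed.

(** Given a core element, any maximizer for the grand coalition also solves the
linear relaxation, at which [f] and its linearization agree. *)
Lemma core_argmax y x : core (game A X f) y ->
    argmax (feasible A X (ones n)) f x ->
  argmax (feasible A (nonneg_orthant m) (ones n)) (linearization f) x /\
  linearization f x = f x.
Proof.
move=> yc xmax; have yd := core_dual_feasible yc.
have y1 : dot (ones n) y = f x.
  by rewrite yc.1 /game (maximum_argmax xmax).
have [[Xx Ax] _] := xmax; have x0 := Xnonneg Xx.
have fx : linearization f x = f x.
  by apply/eqP; rewrite eq_le fle // -y1 dual_bound.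
split=> //; split=> // z [z0 Az].
by rewrite fx -y1; exact: dual_bound.
Qed.

Lemma dual_feasible_nonempty : dual_feasible !=set0.
Proof.
pose K := \sum_j `|f (unit_vec j)|.
have K0 : 0 <= K by apply: sumr_ge0.
(* In each [(y^T A)_j] a single entry 1 of column [j] already contributes [K],
   which bounds every [f e_j], and the other terms are nonnegative. *)
exists (const_mx K); split=> i j; first by rewrite !mxE.
rewrite !mxE (ord1 i).
have [k Akj] : exists k, A k j = 1.
  apply: contrapT => /forallNP noA; apply: (Acol (j := j)).
  by rewrite -colE; apply/colP => k; rewrite !mxE; case: (A01 k j) => // /noA.
have A0 l : 0 <= A l j by case: (A01 l j) => ->.
rewrite (bigD1 k) //= !mxE Akj mulr1 -[leLHS]addr0; apply: lerD.
  apply: le_trans (ler_norm _) _; rewrite /K (bigD1 j) //= lerDl.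
  exact: sumr_ge0.
by apply: sumr_ge0 => l _; rewrite !mxE mulr_ge0.
Qed.

(** The value of the linear relaxation is attained, and equals the value of some
dual feasible point. *)
Lemma lp_game_dual : exists y, dual_feasible y /\
  dot (ones n) y = game A (nonneg_orthant m) (linearization f) (ones n).
Proof.
have [y0 [y0p cy0]] := dual_feasible_nonempty.
have [||x [y [xp Ax yp cy xy]]] :=
    @lp_strong_duality _ _ _ A (ones n) c 0 y0 _ _ y0p cy0.
- by move=> i j; rewrite !mxE.
- by rewrite mulmx0 => i j; rewrite !mxE.
have yd : dual_feasible y by [].
exists y; split=> //; rewrite /game (@maximum_argmax _ _ _ _ x).
  by rewrite dotC linearizationE xy.
split=> // z [z0 Az]; rewrite [leRHS]linearizationE xy.
by have := dual_bound z0 Az yd; rewrite dotC.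
Qed.

Lemma core_nonempty_iff : core (game A X f) !=set0 <->
  game A X f (ones n) = game A (nonneg_orthant m) (linearization f) (ones n).
Proof.
split=> [[y yc]|gameE].
  have [x xmax] := max_attained zero_one_ones.
  have [xlp fx] := core_argmax yc xmax.
  by rewrite /game (maximum_argmax xmax) (maximum_argmax xlp).
have [y [yd y1]] := lp_game_dual.
by exists y; apply: dual_feasible_core; rewrite ?gameE.
Qed.

Lemma core_argmin : core (game A X f) !=set0 ->
  core (game A X f) = argmin dual_feasible (dot (ones n)).
Proof.
move=> [y yc].
have core_min z : dual_feasible z -> game A X f (ones n) <= dot (ones n) z.
  move=> zd; have [x xmax] := max_attained zero_one_ones.
  rewrite /game (maximum_argmax xmax); have [[Xx Ax] _] := xmax.
  apply: le_trans (fle Xx) _.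
  by apply: dual_bound => //; exact: Xnonneg.
apply/seteqP; split=> z.
  move=> zc; split=> [|v /core_min]; first exact: core_dual_feasible.
  by rewrite zc.1.
move=> [zd zmin]; apply: dual_feasible_core => //.
have yd := core_dual_feasible yc.
by apply/eqP; rewrite eq_le core_min // andbT -yc.1 zmin.
Qed.

End RevenueGame.

Theorem theorem1 (R : realType) (n m : nat) (A : 'M[R]_(n, m))
    (X : set 'cV[R]_m) (f : 'cV[R]_m -> R)
    (A01 : zero_one A)
    (Acol : forall j : 'I_m, A *m unit_vec j <> 0)
    (X0 : X 0)
    (Xe : forall j : 'I_m, X (unit_vec j))
    (Xnonneg : X `<=` nonneg_orthant m)
    (f0 : f 0 = 0)
    (fle : forall x : 'cV[R]_m, X x ->
      f x <= \sum_(j < m) f (unit_vec j) * x j 0)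
    (max_attained : forall w : 'cV[R]_n, zero_one w ->
      argmax (feasible A X w) f !=set0) :
  [/\ core (game A X f) !=set0 <->
        game A X f (ones n) =
        game A (nonneg_orthant m) (linearization f) (ones n),
      core (game A X f) !=set0 ->
        core (game A X f) =
        argmin [set y : 'cV[R]_n | nonneg_orthant n y /\
                  lemx (\row_(j < m) f (unit_vec j)) (y^T *m A)]
               (fun y => dot (ones n) y)
    & X = zero_one -> core (game A X f) !=set0 ->
        exists x : 'cV[R]_m,
          argmax (feasible A (nonneg_orthant m) (ones n)) (linearization f) x /\
          forall j : 'I_m, x j 0 \is a Num.int].
Proof.
split.
- exact: core_nonempty_iff.
- exact: core_argmin.
- move=> XE [y yc].
  have [x xmax] := max_attained _ (@zero_one_ones R n).
  have [xlp _] := core_argmax A01 X0 Xe Xnonneg f0 fle max_attained yc xmax.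
  exists x; split=> // j; have [[Xx _] _] := xmax.
  by rewrite XE in Xx; case: (Xx j 0) => ->.
Qed.
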